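(* As formal power series in $q$, $$\sum_{\pi\in\mathcal{P}_{dom}} 2^{\tau(\pi)}\, q^{|\pi|} = \sum_{\pi\in\mathcal{U}_{ic}} q^{|\pi|},$$ where, for a partition $\pi$, $\tau(\pi)$ is the number of different even parts of $\pi$ larger than the smallest positive odd integer that is not a part of $\pi$, and the sets of partitions $\mathcal{P}_{dom}$ and $\mathcal{U}_{ic}$ are as defined in the context.
   Context: A partition $\pi$ is a finite non-increasing sequence of positive integers (its parts), and $|\pi|$ is the sum of the parts. The empty sequence is the unique partition of $0$. $\mathcal{P}_{dom}$ is the set of partitions with distinct odd parts (no odd part is repeated; even parts may repeat) such that the smallest positive integer that is not a part of the partition is odd. $\mathcal{U}_{ic}$ is the set of partitions $\pi$ satisfying the following initial condition: if $2j+1$ is the smallest positive odd number that is not a part of $\pi$, then every even positive integer $\leq j$ appears as a part of $\pi$, and every odd positive integer $\leq j$ appears at least twice as a part of $\pi$. ''Number of different even parts'' means the parts are counted without multiplicity. *)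

(* Defs.v *)
From HB Require Import structures.
From mathcomp Require Import all_boot.

Set Implicit Arguments.
Unset Strict Implicit.
Unset Printing Implicit Defensive.

Definition is_partition (s : seq nat) : bool := sorted geq s && (0 \notin s).

Record partition_of (n : nat) : Type := PartitionOf {
  parts :> seq nat;
  partsP : is_partition parts && (sumn parts == n)
}.

HB.instance Definition _ (n : nat) := [isSub for @parts n].
HB.instance Definition _ (n : nat) := [Countable of partition_of n by <:].

Lemma leq_mem_sumn (s : seq nat) (i : nat) : i \in s -> i <= sumn s.
Proof.
elim: s => //= a s IH; rewrite inE => /orP[/eqP -> | /IH le_i].
  exact: leq_addr.
exact: leq_trans le_i (leq_addl _ _).
Qed.

Lemma leq_size_sumn (s : seq nat) : 0 \notin s -> size s <= sumn s.
Proof.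
elim: s => //= a s IH; rewrite inE negb_or eq_sym -lt0n => /andP[a_gt0 /IH le_s].
by rewrite -add1n leq_add.
Qed.

(* A partition of n has at most n parts, each at most n. *)
Definition bseq_of_partition (n : nat) (p : partition_of n) :
  {bseq n of 'I_n.+1} := insub_bseq n (map inord p).

Definition partition_of_bseq (n : nat) (b : {bseq n of 'I_n.+1}) :
  option (partition_of n) := insub (map val b).

Lemma bseq_of_partitionK (n : nat) :
  pcancel (@bseq_of_partition n) (@partition_of_bseq n).
Proof.
move=> p; rewrite /partition_of_bseq /bseq_of_partition.
have /andP[/andP[_ p_pos] /eqP sum_p] := partsP p.
have -> : map val (insub_bseq n (map (@inord n) p)) = p.
  rewrite /insub_bseq insubdK; last first.
    rewrite unfold_in size_map.
    by apply: leq_trans (leq_size_sumn p_pos) _; rewrite sum_p.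
  rewrite -map_comp; apply: map_id_in => i /leq_mem_sumn.
  by rewrite sum_p => le_in /=; rewrite inordK.
exact: valK.
Qed.

HB.instance Definition _ (n : nat) :=
  isFinite.Build (partition_of n) (pcan_enumP (@bseq_of_partitionK n)).

Lemma mex_exists (s : seq nat) : exists i, (0 < i) && (i \notin s).
Proof.
exists (sumn s).+1; rewrite ltn0Sn /=.
by apply/negP => /leq_mem_sumn; rewrite ltnn.
Qed.

Lemma odd_mex_exists (s : seq nat) : exists i, odd i && (i \notin s).
Proof.
exists (sumn s).*2.+1; rewrite oddS odd_double /=.
by apply/negP => /leq_mem_sumn; rewrite leqNgt ltnS -addnn leq_addr.
Qed.

Definition mex (s : seq nat) : nat := ex_minn (mex_exists s).

Definition odd_mex (s : seq nat) : nat := ex_minn (odd_mex_exists s).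

Definition P_dom (s : seq nat) : bool :=
  uniq [seq i <- s | odd i] && odd (mex s).

(* The initial condition, with [j] determined by [odd_mex s = j.*2.+1]. *)
Definition U_ic (s : seq nat) : bool :=
  let j := (odd_mex s)./2 in
  all (fun i => if odd i then 1 < count_mem i s else i \in s) (iota 1 j).

Definition tau (s : seq nat) : nat :=
  count (fun i => ~~ odd i && (odd_mex s < i)) (undup s).

(* A formal power series in q is represented by its coefficient sequence.    *)
(* [gen_series A w] is the sum of w(p) q^|p| over the partitions p in A: its *)
(* n-th coefficient collects the finitely many terms with |p| = n.           *)
Definition power_series : Type := nat -> nat.

Definition gen_series (A : pred (seq nat)) (w : seq nat -> nat) : power_series :=
  fun n => \sum_(p : partition_of n | A p) w p.

(* Main.v *)
(** Both sides are split according to the smallest missing odd number 2j+1.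
Prescribing the multiplicity of each part separately turns the j-th
contribution into a product over the parts, and after division by
1/(q;q)_oo the claim becomes the false theta identity
  sum_j q^(j(2j+1)) / (-q;q)_(2j+1) = sum_j q^(j(3j+1)/2) (1 - q^(2j+1)).
The left-hand side is sum_n (-1)^n q^(n(n+1)/2) / (-q;q)_n with consecutive
terms paired.  The sums
  f_m = sum_n (-1)^n q^(n(n+1)/2 + 2mn) / (-q^(m+1);q)_n
satisfy f_m = 1 - q^(2m+1) + q^(3m+2) f_(m+1) by telescoping, and iterating
from f_0 produces the right-hand side.
Power series are truncated by letting q be a nilpotent element x, and the
denominators (-q^(m+1);q)_n are avoided by multiplying by (-q^(m+1);q)_oo. *)

Require Import Defs.
From mathcomp Require Import all_boot all_order all_algebra.
From mathcomp Require Import ring zify.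

Set Implicit Arguments.
Unset Strict Implicit.
Unset Printing Implicit Defensive.

Import GRing.Theory.

(** * The smallest missing odd number *)

Lemma odd_mexP (s : seq nat) j : reflect
  (j.*2.+1 \notin s /\ forall i, odd i -> i < j.*2.+1 -> i \in s)
  (odd_mex s == j.*2.+1).
Proof.
rewrite /odd_mex; case: ex_minnP => m /andP[m_odd m_notin] m_min.
apply: (iffP eqP) => [m_eq | [j_notin j_min]].
  split=> [|i i_odd lt_i]; first by rewrite -m_eq.
  apply: contraLR lt_i => i_notin; rewrite -leqNgt -m_eq.
  by apply: m_min; rewrite i_odd.
apply/eqP; rewrite eqn_leq m_min ?j_notin ?andbT /= ?odd_double //.
by rewrite leqNgt; apply: contra m_notin; apply: j_min.
Qed.

Lemma odd_mexE (s : seq nat) : odd_mex s = (odd_mex s)./2.*2.+1.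
Proof.
rewrite /odd_mex; case: ex_minnP => m /andP[m_odd _] _.
by rewrite -[in LHS](odd_double_half m) m_odd.
Qed.

(** An odd mex is itself the smallest missing odd number, so no smaller positive number is
    missing. *)
Lemma odd_mex_odd (s : seq nat) j : odd_mex s = j.*2.+1 ->
  odd (mex s) <-> forall i, 0 < i < j.*2.+1 -> i \in s.
Proof.
move/eqP/odd_mexP => [j_notin j_min]; rewrite /mex.
case: ex_minnP => m /andP[m_gt0 m_notin] m_min.
split=> [m_odd i /andP[i_gt0 lt_i]|j_in].
  have le_jm : j.*2.+1 <= m.
    by rewrite leqNgt; apply: contra m_notin; apply: j_min.
  apply: contraLR (leq_trans lt_i le_jm) => i_notin; rewrite -leqNgt.
  by apply: m_min; rewrite i_gt0.
suff -> : m = j.*2.+1 by rewrite /= odd_double.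
apply/eqP; rewrite eqn_leq m_min //= leqNgt.
by apply: contra m_notin => lt_m; rewrite j_in // m_gt0.
Qed.

Lemma uniq_odd_count (s : seq nat) :
  uniq [seq i <- s | odd i] <-> forall i, odd i -> count_mem i s <= 1.
Proof.
have cnt i : count_mem i [seq i <- s | odd i] = odd i * count_mem i s.
  rewrite count_filter; case: (boolP (odd i)) => odd_i.
    rewrite mul1n; apply: eq_count => k /=.
    by case: eqP => // ->; rewrite odd_i.
  rewrite mul0n; apply/eqP; rewrite -leqn0 leqNgt -has_count.
  by apply/hasPn => k _ /=; case: eqP => // ->.
split=> [s_uniq i odd_i | le1].
  have := cnt i; rewrite odd_i mul1n => <-.
  by rewrite count_uniq_mem ?leq_b1.
apply: count_mem_uniq => i; rewrite -has_pred1 has_count cnt.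
by case: (boolP (odd i)) => [/le1|//]; case: count => [|[]].
Qed.

(** * Membership conditions as products over part sizes *)

Lemma prodn_bool (b : pred nat) r : \prod_(i <- r) (b i : nat) = all b r.
Proof. by elim: r => [|i r IH]; rewrite ?big_nil // big_cons IH /= mulnb. Qed.

(** [k] stands for the multiplicity of the part [i]. The middle conjunct encodes the odd mex: all of
    1, ..., 2j must occur. *)
Definition dom_cond j i k :=
  [&& odd i ==> (k <= 1), (i < j.*2.+1) ==> (0 < k) & (i == j.*2.+1) ==> (k == 0)].

(** Each even size counted by [tau] contributes one factor 2, whatever its positive multiplicity. *)
Definition dom_weight j i k :=
  dom_cond j i k * 2 ^ [&& ~~ odd i, j.*2.+1 < i & 0 < k].

(** The first two conjuncts make 2j+1 the smallest missing odd number; the third is the initial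
    condition. *)
Definition uic_cond j i k :=
  [&& odd i && (i < j.*2.+1) ==> (0 < k), (i == j.*2.+1) ==> (k == 0) &
    (i <= j) ==> if odd i then 1 < k else 0 < k].

Section ConditionsAsProducts.
Variables (s : seq nat) (M : nat).
Hypothesis s_le : forall i, i \in s -> 0 < i <= M.

Lemma mem_count i : (i \in s) = (0 < count_mem i s).
Proof. by rewrite -has_pred1 has_count. Qed.

Lemma dom_condP j : j.*2.+1 <= M ->
  all (fun i => dom_cond j i (count_mem i s)) (index_iota 1 M.+1) =
  P_dom s && (odd_mex s == j.*2.+1).
Proof.
move=> le_jM; apply/allP/idP => [H | /andP[/andP[/uniq_odd_count s_odd s_mex] /eqP s_om]].
  have H1 i : 0 < i <= M -> dom_cond j i (count_mem i s).
    by move=> i_le; apply: H; rewrite mem_index_iota.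
  have H2 i : 0 < i < j.*2.+1 -> i \in s.
    move=> /andP[i_gt0 lt_i]; rewrite mem_count.
    have /H1/and3P[_ + _] : 0 < i <= M by rewrite i_gt0 (leq_trans (ltnW lt_i)).
    by rewrite lt_i.
  have om : odd_mex s = j.*2.+1.
    apply/eqP/odd_mexP; split=> [|i odd_i lt_i]; last by apply: H2; rewrite odd_gt0.
    by rewrite mem_count; have /and3P[_ _] := H1 j.*2.+1 le_jM; rewrite eqxx => /eqP ->.
  rewrite om eqxx andbT; apply/andP; split; last by apply/(odd_mex_odd om).
  apply/uniq_odd_count => i odd_i; case: (boolP (i \in s)) => [/s_le /H1|].
    by rewrite /dom_cond odd_i => /andP[].
  by rewrite mem_count -leqNgt leqn0 => /eqP ->.
move=> i; rewrite mem_index_iota => /andP[i_gt0 _]; apply/and3P; split.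
- by apply/implyP/s_odd.
- apply/implyP => lt_i; rewrite -mem_count.
  by move/(odd_mex_odd s_om): s_mex; apply; rewrite i_gt0.
- apply/implyP => /eqP ->; rewrite -leqn0 leqNgt -mem_count.
  by move/eqP/odd_mexP: s_om => [].
Qed.

Lemma tau_sum j : odd_mex s = j.*2.+1 ->
  tau s = \sum_(1 <= i < M.+1) [&& ~~ odd i, j.*2.+1 < i & 0 < count_mem i s].
Proof.
move=> om; rewrite /tau om; pose Q i := [&& ~~ odd i, j.*2.+1 < i & 0 < count_mem i s].
rewrite -[RHS](big_map (fun i => nat_of_bool (Q i)) xpredT id) -sumnE sumn_count.
rewrite -!size_filter.
apply/perm_size/uniq_perm; rewrite ?filter_uniq ?undup_uniq ?iota_uniq // => i.
rewrite !mem_filter mem_undup mem_index_iota /Q -mem_count -!andbA.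
by case: (boolP (i \in s)) => [/s_le -> | _]; rewrite ?andbF.
Qed.

Lemma prod_dom_weight j : j.*2.+1 <= M ->
  \prod_(1 <= i < M.+1) dom_weight j i (count_mem i s) =
  (P_dom s && (odd_mex s == j.*2.+1)) * 2 ^ tau s.
Proof.
move=> le_jM; rewrite big_split /= prodn_bool dom_condP //.
case: (boolP (odd_mex s == _)) => [/eqP om|]; last by rewrite andbF.
by rewrite -expn_sum -(tau_sum om).
Qed.

Lemma uic_condP j : j.*2.+1 <= M ->
  all (fun i => uic_cond j i (count_mem i s)) (index_iota 1 M.+1) =
  U_ic s && (odd_mex s == j.*2.+1).
Proof.
move=> le_jM; apply/allP/idP => [H | /andP[+ /eqP s_om]].
  have H1 i : 0 < i <= M -> uic_cond j i (count_mem i s).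
    by move=> i_le; apply: H; rewrite mem_index_iota.
  have om : odd_mex s = j.*2.+1.
    apply/eqP/odd_mexP; split=> [|i odd_i lt_i].
      by rewrite mem_count; have /and3P[_ + _] := H1 j.*2.+1 le_jM; rewrite eqxx => /eqP ->.
    rewrite mem_count; have /H1/and3P[+ _ _] : 0 < i <= M.
      by rewrite odd_gt0 // (leq_trans (ltnW lt_i)).
    by rewrite odd_i lt_i.
  rewrite om eqxx andbT /U_ic om /= uphalf_double; apply/allP => i.
  rewrite mem_iota add1n ltnS => /andP[i_gt0 le_ij].
  have /H1/and3P[_ _] : 0 < i <= M by rewrite i_gt0 /=; lia.
  by rewrite le_ij -mem_count.
rewrite /U_ic s_om /= uphalf_double => /allP H i.
rewrite mem_index_iota => /andP[i_gt0 _].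
have [j_notin j_min] := odd_mexP _ _ (introT eqP s_om).
apply/and3P; split; apply/implyP.
- by case/andP=> odd_i lt_i; rewrite -mem_count j_min.
- by move=> /eqP ->; rewrite -leqn0 leqNgt -mem_count.
- by move=> le_ij; rewrite -mem_count; apply: H; rewrite mem_iota i_gt0.
Qed.

Lemma prod_uic_cond j : j.*2.+1 <= M ->
  \prod_(1 <= i < M.+1) (uic_cond j i (count_mem i s) : nat) =
  (U_ic s && (odd_mex s == j.*2.+1)).
Proof. by move=> le_jM; rewrite prodn_bool uic_condP. Qed.

End ConditionsAsProducts.

Lemma sum_odd_mex (A : pred (seq nat)) (w : seq nat -> nat) n
    (p : partition_of n) :
  \sum_(j < n.+1) (A p && (odd_mex p == j.*2.+1)) * w p = A p * w p.
Proof.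
have /andP[_ /eqP sum_p] := partsP p.
(* If 2j+1 is the smallest missing odd number and j > 0, then 2j-1 is a part, so 2j-1 <= n and j <=
   n. *)
have lt_j : (odd_mex p)./2 < n.+1.
  have [_] := odd_mexP _ _ (introT eqP (odd_mexE p)).
  case: (_./2) => // j /(_ j.*2.+1); rewrite /= odd_double doubleS !ltnS leqnSn.
  by move=> /(_ isT isT)/leq_mem_sumn; rewrite sum_p -addnn; lia.
rewrite (bigD1 (Ordinal lt_j)) //= -odd_mexE eqxx andbT big1 ?addn0 // => i.
case: (odd_mex p =P i.*2.+1) => [om /eqP[]|_ _]; last by rewrite andbF.
by apply: val_inj; rewrite /= om /= uphalf_double.
Qed.

(** * The false theta identity for a nilpotent variable *)

Local Open Scope ring_scope.

Section NilpotentVariable.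
Variables (R : comNzRingType) (x : R) (M : nat).
Hypothesis x_nilp : x ^+ M.+1 = 0.

(* The Pochhammer symbol (-x^(m+1); x)_oo, all factors beyond x^M being 1. *)
Definition pochN m := \prod_(m.+1 <= k < M.+1) (1 + x ^+ k).

Lemma expr_nilp_eq0 n : (M < n)%N -> x ^+ n = 0.
Proof. by move=> /subnKC <-; rewrite exprD x_nilp mul0r. Qed.

Lemma pochN_rec m : pochN m = (1 + x ^+ m.+1) * pochN m.+1.
Proof.
rewrite /pochN; case: (ltnP m M) => ltmM; first by rewrite big_ltn.
by rewrite !big_geq ?expr_nilp_eq0 ?addr0 ?mulr1 // ltnW.
Qed.

(* This is f_m times (-x^(m+1); x)_oo, in the notation of the header. *)
Definition rogers_sum m :=
  \sum_(n < M.+1) (-1) ^+ n * x ^+ ('C(n.+1, 2) + 2 * m * n) * pochN (m + n).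

Lemma leq_bin2S n : (n <= 'C(n.+1, 2))%N.
Proof. by case: n => // n; rewrite binS bin1 leq_addl. Qed.

(** This is the recurrence for f_m multiplied by [pochN m]; the factor 1 + x^(m+1) turns
    [pochN m.+1] into [pochN m]. *)
Lemma rogers_sum_rec m : rogers_sum m =
  (1 - x ^+ (2 * m).+1) * pochN m +
  x ^+ (3 * m).+2 * (1 + x ^+ m.+1) * rogers_sum m.+1.
Proof.
(* With a_n the n-th term of [rogers_sum m] and b_n that of the last summand,
   a_n - b_n = c_n - c_(n+1). *)
pose c n := (-1) ^+ n * x ^+ ('C(n.+1, 2) + 2 * m * n) * pochN (m + n) *
  (1 - x ^+ (2 * m + n).+1).
have c0 : c 0%N = (1 - x ^+ (2 * m).+1) * pochN m.
  by rewrite /c muln0 !addn0 expr0 !mul1r mulrC.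
(* The upper end of the telescoping sum vanishes, its exponent being at least M+1. *)
have cM : c M.+1 = 0.
  rewrite /c (@expr_nilp_eq0 ('C(M.+2, 2) + _)) ?mulr0 ?mul0r //.
  by apply: leq_trans (leq_addr _ _); apply: leq_bin2S.
apply/eqP; rewrite -subr_eq mulr_sumr -sumrB; apply/eqP.
under eq_bigr => n _.
  have -> : (-1) ^+ n * x ^+ ('C(n.+1, 2) + 2 * m * n) * pochN (m + n) -
     x ^+ (3 * m).+2 * (1 + x ^+ m.+1) *
     ((-1) ^+ n * x ^+ ('C(n.+1, 2) + 2 * m.+1 * n) * pochN (m.+1 + n))
     = - (c n.+1 - c n).
    rewrite /c (binS n.+1) bin1 (addSn m n) (addnS m n) (pochN_rec (m + n)).
    (* Splitting off a common exponent e leaves a polynomial identity in x, x^m, x^n, x^e and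
       [d]. *)
    have -> : ('C(n.+1, 2) + n.+1 + 2 * m * n.+1 =
      ('C(n.+1, 2) + 2 * m * n) + (n + m + m + 1))%N by lia.
    have -> : ('C(n.+1, 2) + 2 * m.+1 * n =
      ('C(n.+1, 2) + 2 * m * n) + n + n)%N by lia.
    have -> : ((3 * m).+2 = m + m + m + 2)%N by lia.
    have -> : ((2 * m + n).+1 = m + m + n + 1)%N by lia.
    have -> : ((2 * m + n.+1).+1 = m + m + n + 2)%N by lia.
    have -> : ((m + n).+1 = m + n + 1)%N by lia.
    move: ('C(_, 2) + _)%N (pochN _) => e d.
    rewrite !exprS !exprD !expr1 !mulN1r.
    ring.
  over.
rewrite sumrN -(big_mkord xpredT (fun n => c n.+1 - c n)) telescope_sumr // cM c0.
ring.
Qed.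

Lemma pochN0_split j : pochN 0 = \prod_(1 <= i < j.+1) (1 + x ^+ i) * pochN j.
Proof.
elim: j => [|j IH]; first by rewrite big_geq ?mul1r.
by rewrite big_nat_recr //= -mulrA -pochN_rec.
Qed.

(** The powers x^(3i+2) for i < j multiply to x^(j(3j+1)/2), and j(3j+1)/2 = C(j+1,2) + j^2. *)
Lemma rogers_sum0_iter j : rogers_sum 0 =
  pochN 0 * \sum_(i < j) x ^+ ('C(i.+1, 2) + i ^ 2) * (1 - x ^+ i.*2.+1)
  + x ^+ ('C(j.+1, 2) + j ^ 2) * \prod_(1 <= i < j.+1) (1 + x ^+ i) * rogers_sum j.
Proof.
elim: j => [|j IH]; first by rewrite big_ord0 big_geq // mulr0 add0r expr0 !mul1r.
rewrite IH big_ord_recr /= -mul2n [\prod_(1 <= i < j.+2) _]big_nat_recr //= rogers_sum_rec.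
have -> : ('C(j.+2, 2) + j.+1 ^ 2 = 'C(j.+1, 2) + j ^ 2 + (3 * j).+2)%N.
  by rewrite binS bin1; lia.
rewrite [x ^+ (_ + (3 * j).+2)]exprD (pochN0_split j).
move: (\sum_(_ < _) _) (\prod_(_ <= _ < _) _) (x ^+ ('C(_, 2) + _)) (x ^+ _.+2).
by move=> s p y z; ring.
Qed.

(** Terms 2j and 2j+1 combine because [pochN] at 2j minus x^(2j+1) times [pochN] at 2j+1 is [pochN]
    at 2j+1. *)
Lemma sum_sign_pair N : \sum_(i < N.*2) (-1) ^+ i * x ^+ 'C(i.+1, 2) * pochN i
  = \sum_(j < N) x ^+ 'C(j.*2.+1, 2) * pochN j.*2.+1.
Proof.
elim: N => [|N IH]; first by rewrite !big_ord0.
rewrite doubleS !big_ord_recr /= IH -addrA; congr (_ + _).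
rewrite (pochN_rec N.*2) (binS N.*2.+1) bin1 -(signr_odd _ N.*2) -(signr_odd _ N.*2.+1) /=.
rewrite odd_double exprD expr0 expr1.
ring.
Qed.

Lemma rogers_false_theta N : M = N.*2.+1 ->
  \sum_(j < N.+1) x ^+ 'C(j.*2.+1, 2) * pochN j.*2.+1 =
  pochN 0 * \sum_(j < N.+1) x ^+ ('C(j.+1, 2) + j ^ 2) * (1 - x ^+ j.*2.+1).
Proof.
move=> eM.
(* After N+1 iterations the remainder carries a power of x beyond M = 2N+1. As M is odd, the M+1
   signed terms pair up exactly. *)
have := rogers_sum0_iter N.+1; rewrite [X in _ + X * _ * _]expr_nilp_eq0; last first.
  rewrite eM binS bin1; have := leq_bin2S N; lia.
rewrite !mul0r addr0 => <-.
rewrite -sum_sign_pair /rogers_sum eM -doubleS; apply: eq_bigr => i _.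
by rewrite addn0 add0n.
Qed.

(** * Generating functions of a single part size *)

Definition geom i := \sum_(k < M.+1) x ^+ (i * k).

Definition mult_series i (f : nat -> nat) := \sum_(k < M.+1) (f k)%:R * x ^+ (i * k).

Lemma geom_inv i : (0 < i)%N -> (1 - x ^+ i) * geom i = 1.
Proof.
move=> i_gt0; rewrite /geom; under eq_bigr do rewrite exprM.
rewrite -opprB mulNr -subrX1 -exprM expr_nilp_eq0 ?sub0r ?opprK //.
exact: leq_pmull.
Qed.

Lemma mult_series_const i f c : (forall k, f k = c) -> mult_series i f = c%:R * geom i.
Proof. by move=> fc; rewrite mulr_sumr; apply: eq_bigr => k _; rewrite fc. Qed.

Lemma mult_series_rec i f : (0 < i)%N ->
  mult_series i f = (f 0%N)%:R + x ^+ i * mult_series i (f \o succn).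
Proof.
move=> i_gt0; rewrite /mult_series big_ord_recl muln0 mulr1; congr (_ + _).
rewrite big_ord_recr mulrDr [X in _ + X]mulrCA -exprD -mulnS.
rewrite (@expr_nilp_eq0 (i * M.+1)) ?leq_pmull // mulr0 addr0 mulr_sumr.
by apply: eq_bigr => k _; rewrite mulrCA -exprD -mulnS.
Qed.

(** Both conditions only distinguish the multiplicities 0, 1 and at least 2. *)
Lemma mult_series_ev_const i f c : (0 < i)%N -> (forall k, f k.+2 = c) ->
  mult_series i f = (f 0%N)%:R + x ^+ i * ((f 1%N)%:R + x ^+ i * (c%:R * geom i)).
Proof.
by move=> i_gt0 fc; rewrite mult_series_rec // mult_series_rec // (mult_series_const i fc).
Qed.

Lemma prod_expr n : \prod_(1 <= i < n.+1) x ^+ i = x ^+ 'C(n.+1, 2).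
Proof.
elim: n => [|n IH]; first by rewrite big_geq.
by rewrite big_nat_recr //= IH -exprD [in RHS]binS bin1.
Qed.

Lemma prod_odd_expr n : \prod_(1 <= i < n.*2.+1 | odd i) x ^+ i = x ^+ (n ^ 2).
Proof.
elim: n => [|n IH]; first by rewrite big_geq.
rewrite doubleS big_mkcond big_nat_recr //= big_nat_recr //= -big_mkcond IH.
rewrite odd_double /= mulr1 -exprD; congr (x ^+ _); lia.
Qed.

(** Euler's theorem on odd and distinct parts: multiplying (1 - x^i)(1 + x^i) = 1 - x^(2i) over all
    i leaves only the even factors, which are then cancelled by their inverse. *)
Lemma prod_odd_geom : \prod_(1 <= i < M.+1 | odd i) geom i = pochN 0.
Proof.
pose Q P := \prod_(1 <= i < M.+1 | P i) (1 - x ^+ i).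
pose G P := \prod_(1 <= i < M.+1 | P i) geom i.
have QG P : Q P * G P = 1.
  rewrite -big_split big1_seq // => i /andP[_]; rewrite mem_index_iota => /andP[i_gt0 _].
  exact: geom_inv.
have even_sq : Q odd * pochN 0 = 1.
  have eQ : Q odd * Q (predC odd) * pochN 0 = Q (predC odd).
    have -> : Q odd * Q (predC odd) = \prod_(1 <= i < M.+1) (1 - x ^+ i).
      by rewrite [RHS](bigID odd).
    rewrite /Q /pochN -big_split.
    under eq_bigr => i _ do rewrite /= -subr_sqr expr1n -exprM muln2.
    have aux n : \prod_(1 <= i < n.*2.+1 | ~~ odd i) (1 - x ^+ i) =
        \prod_(1 <= i < n.+1) (1 - x ^+ i.*2).
      elim: n => [|n IH]; first by rewrite !big_geq.
      rewrite doubleS big_mkcond big_nat_recr //= big_nat_recr //= -big_mkcond IH.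
      by rewrite odd_double /= mulr1 [in RHS]big_nat_recr.
    (* The even factors now run up to 2M; those with index above M equal 1. *)
    rewrite -aux -addnn (@big_cat_nat _ _ _ M.+1) ?ltnS ?leq_addr //=.
    rewrite [X in _ * X]big1_seq ?mulr1 // => i /andP[_].
    by rewrite mem_index_iota => /andP[/expr_nilp_eq0 -> _]; rewrite subr0.
  rewrite -[LHS]mulr1 -(QG (predC odd)) -[in RHS]eQ; ring.
by rewrite -/(G odd) -[LHS]mulr1 -even_sq mulrCA mulrA QG mul1r.
Qed.

(** The weight 2 makes even and odd sizes above 2j+1 alike: 1 + 2x^i/(1 - x^i) = (1 + x^i)/(1 -
    x^i), against 1 + x^i for odd i. *)
Lemma mult_series_dom j i : (0 < i)%N ->
  mult_series i (dom_weight j i) = (if odd i then 1 else geom i) *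
    (if (i < j.*2.+1)%N then x ^+ i else if i == j.*2.+1 then 1 else 1 + x ^+ i).
Proof.
move=> i_gt0; have geom_eq : x ^+ i * geom i = geom i - 1.
  by rewrite -(geom_inv i_gt0); ring.
rewrite (@mult_series_ev_const _ _ (dom_weight j i 2)) // /dom_weight /dom_cond.
have [lt_i|gt_i|eq_i] := ltngtP i j.*2.+1; have [odd_i|even_i] := boolP (odd i);
  rewrite /= ?(expn0, expn1, muln1, muln0, mul1n, mul0n); try by ring: geom_eq.
by rewrite eq_i /= odd_double in even_i.
Qed.

(** Each i <= j forces one copy and each odd i < 2j+1 one more, so odd i <= j occur at least twice.
    The factor 1 - x^i cancels [geom i] at the missing part. *)
Lemma mult_series_uic j i : (0 < i)%N ->
  mult_series i (fun k => uic_cond j i k) = geom i *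
    ((if (i <= j)%N then x ^+ i else 1) *
    ((if odd i && (i < j.*2.+1)%N then x ^+ i else 1) *
    (if i == j.*2.+1 then 1 - x ^+ i else 1))).
Proof.
move=> i_gt0; have geom_eq : x ^+ i * geom i = geom i - 1.
  by rewrite -(geom_inv i_gt0); ring.
rewrite (@mult_series_ev_const _ _ (uic_cond j i 2)) // /uic_cond.
have [lt_i|gt_i|eq_i] := ltngtP i j.*2.+1; have [odd_i|even_i] := boolP (odd i);
  have [le_i|gt_ij] := leqP i j; rewrite /=; try by ring: geom_eq.
all: by exfalso; lia.
Qed.

Lemma prod_dom_factor j : (j.*2.+1 <= M)%N ->
  \prod_(1 <= i < M.+1) (if (i < j.*2.+1)%N then x ^+ i
    else if i == j.*2.+1 then 1 else 1 + x ^+ i)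
  = x ^+ 'C(j.*2.+1, 2) * pochN j.*2.+1.
Proof.
move=> le_jM; rewrite (@big_cat_nat _ _ _ j.*2.+1) ?ltnS ?(ltnW le_jM) //=.
rewrite -(prod_expr j.*2); congr (_ * _).
  by apply: eq_big_nat => i /andP[_ ->].
rewrite big_ltn ?ltnS // ltnn eqxx mul1r; apply: eq_big_nat => i /andP[lt_i _].
by rewrite ltnNge (ltnW lt_i) gtn_eqF.
Qed.

(** The forced copies have total size 1 + 2 + ... + j plus 1 + 3 + ... + (2j-1). *)
Lemma prod_uic_factor j : (j.*2.+1 <= M)%N ->
  \prod_(1 <= i < M.+1) ((if (i <= j)%N then x ^+ i else 1) *
    ((if odd i && (i < j.*2.+1)%N then x ^+ i else 1) *
    (if i == j.*2.+1 then 1 - x ^+ i else 1)))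
  = x ^+ ('C(j.+1, 2) + j ^ 2) * (1 - x ^+ j.*2.+1).
Proof.
move=> le_jM; rewrite !big_split /= mulrA exprD -prod_expr -prod_odd_expr.
rewrite -!big_mkcond /=; congr (_ * _ * _).
- by rewrite [RHS](big_nat_widen _ _ M.+1) //; lia.
- by rewrite [RHS](big_nat_widen _ _ M.+1) //; lia.
- by rewrite big_nat1_eq /= ltnS le_jM.
Qed.

End NilpotentVariable.

(** * Partitions as multiplicity vectors *)

Section PartitionSeries.

Lemma sum_count_mem (s : seq nat) M : (forall i, i \in s -> 0 < i <= M)%N ->
  (\sum_(i < M) i.+1 * count_mem i.+1 s)%N = sumn s.
Proof.
elim: s => [|a s IH] s_le /=; first by rewrite big1 // => i _; rewrite muln0.
under eq_bigr do rewrite mulnDr; rewrite big_split /= IH; last first.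
  by move=> i i_s; apply: s_le; rewrite inE i_s orbT.
congr (_ + _)%N; have /andP[a_gt0 le_aM] := s_le a (mem_head _ _).
have lt_a : (a.-1 < M)%N by rewrite prednK.
rewrite (bigD1 (Ordinal lt_a)) //= prednK // eqxx muln1 big1 ?addn0 // => i.
case: (a =P i.+1) => [a_eq /eqP[]|]; last by rewrite muln0.
by apply: val_inj; rewrite /= a_eq.
Qed.

Variables n M : nat.
Hypothesis le_nM : (n <= M)%N.

Lemma partition_part (p : partition_of n) i : i \in parts p -> (0 < i <= n)%N.
Proof.
have /andP[/andP[_ p_pos] /eqP sum_p] := partsP p => i_p.
have := leq_mem_sumn i_p; rewrite sum_p => ->; rewrite andbT lt0n.
by apply: contraNneq p_pos => <-.
Qed.

(** Index [i] records the part i+1. [inord] loses nothing, as multiplicities are at most n <= M. *)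
Definition mults (p : partition_of n) : {ffun 'I_M -> 'I_M.+1} :=
  [ffun i : 'I_M => inord (count_mem i.+1 p)].

Lemma multsE (p : partition_of n) (i : 'I_M) : mults p i = count_mem i.+1 p :> nat.
Proof.
rewrite ffunE inordK // ltnS; apply: leq_trans le_nM.
apply: leq_trans (count_size _ _) _.
have /andP[/andP[_ p_pos] /eqP sum_p] := partsP p.
by have := leq_size_sumn p_pos; rewrite sum_p.
Qed.

Lemma mults_inj : injective mults.
Proof.
move=> p r eq_pr; apply: val_inj => /=.
have /andP[/andP[p_sorted _] _] := partsP p.
have /andP[/andP[r_sorted _] _] := partsP r.
apply: (sorted_eq _ _ p_sorted r_sorted).
- by move=> a b c /= le1 le2; apply: leq_trans le2 le1.
- by move=> a b ge_ab; apply/eqP; rewrite eqn_leq andbC.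
apply/allP => /= i _; apply/eqP.
have [i_in|] := boolP (0 < i <= M)%N.
  case/andP: i_in => i_gt0 le_i; have lt_i : (i.-1 < M)%N by rewrite prednK.
  by have := multsE p (Ordinal lt_i); rewrite eq_pr multsE /= prednK.
have out (t : partition_of n) : ~~ (0 < i <= M)%N -> count_mem i t = 0%N.
  move=> i_out; apply/count_memPn; apply: contra i_out => /partition_part /andP[-> le_i].
  exact: leq_trans le_nM.
by move=> i_out; rewrite !out.
Qed.

Lemma mem_mults (f : {ffun 'I_M -> 'I_M.+1}) :
  (f \in mults @: [set: partition_of n]) = (\sum_(i < M) i.+1 * f i == n)%N.
Proof.
apply/imsetP/eqP => [[p _ ->]|sum_f].
  under eq_bigr do rewrite multsE.
  rewrite sum_count_mem; first by have /andP[_ /eqP] := partsP p.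
  by move=> i /partition_part /andP[-> le_i]; exact: leq_trans le_nM.
(* The preimage of [f] has [f i] copies of each i+1. *)
pose s := sort geq (flatten [seq nseq (f i) i.+1 | i : 'I_M]).
have s_mem i : i \in s -> (0 < i <= M)%N.
  rewrite mem_sort => /flatten_mapP[k _]; rewrite mem_nseq => /andP[_ /eqP ->].
  by rewrite ltn_ord.
have s_count (i : 'I_M) : count_mem i.+1 s = f i.
  rewrite (permP (permEl (perm_sort _ _))) count_flatten -map_comp sumnE big_map.
  rewrite big_enum (bigD1 i) //= count_nseq /= eqxx mul1n big1 ?addn0 // => k ne_ki.
  rewrite count_nseq /= eqSS; case: eqP => // eq_ki.
  by case/eqP: ne_ki; apply: val_inj.
have s_part : is_partition s && (sumn s == n).
  rewrite -(sum_count_mem s_mem); under eq_bigr do rewrite s_count.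
  rewrite sum_f eqxx andbT; apply/andP; split; last by apply/negP => /s_mem.
  by apply: sort_sorted => a b; apply: leq_total.
exists (PartitionOf s_part) => //; apply/ffunP => i; apply: ord_inj.
by rewrite multsE /= s_count.
Qed.

(** Expanding the product gives one monomial per multiplicity vector; those of degree n are exactly
    the partitions of n. *)
Lemma partition_series (W : nat -> nat -> nat) :
  (\sum_(p : partition_of n) \prod_(1 <= i < M.+1) W i (count_mem i p))%N%:R =
  (\prod_(1 <= i < M.+1) mult_series ('X : {poly int}) M i (W i))`_n.
Proof.
rewrite big_add1 big_mkord bigA_distr_bigA /= coef_sum.
have term (f : {ffun 'I_M -> 'I_M.+1}) :
  (\prod_(i < M) ((W i.+1 (f i))%:R * 'X^(i.+1 * f i)) : {poly int})`_n =
  if (\sum_(i < M) i.+1 * f i == n)%N then (\prod_(i < M) W i.+1 (f i))%N%:R else 0.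
  rewrite big_split /= -natr_prod -expr_sum mulr_natl coefMn coefXn eq_sym.
  by case: eqP; rewrite ?mul0rn.
rewrite (eq_bigr _ (fun f _ => term f)) -big_mkcond /= natr_sum.
under [RHS]eq_bigl do rewrite -mem_mults.
rewrite big_imset /=; last by move=> p r _ _; exact: mults_inj.
under [RHS]eq_bigl do rewrite inE.
apply: eq_bigr => p _; rewrite big_add1 big_mkord; congr (_%:R).
by apply: eq_bigr => i _; rewrite multsE.
Qed.

End PartitionSeries.

(* The bound 2n+1 keeps the missing odd number 2j+1 in range for all j <= n. *)
Lemma gen_series_coef (A : pred (seq nat)) (w : seq nat -> nat)
    (W : nat -> nat -> nat -> nat) n :
  let M := n.*2.+1 in
  (forall (s : seq nat) j, (forall i, i \in s -> 0 < i <= M)%N -> (j.*2.+1 <= M)%N ->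
    (\prod_(1 <= i < M.+1) W j i (count_mem i s) =
     (A s && (odd_mex s == j.*2.+1)) * w s)%N) ->
  (gen_series A w n)%:R =
  (\sum_(j < n.+1) \prod_(1 <= i < M.+1) mult_series ('X : {poly int}) M i (W j i))`_n.
Proof.
move=> M WE; have le_nM : (n <= M)%N by rewrite /M -addnn; lia.
rewrite coef_sum; under eq_bigr do rewrite -partition_series //.
rewrite -natr_sum exchange_big /gen_series big_mkcond /=; congr (_%:R).
apply: eq_bigr => p _; rewrite -mulnbl -sum_odd_mex.
apply: eq_bigr => j _; rewrite WE //.
  by move=> i /partition_part /andP[-> le_i]; apply: leq_trans le_nM.
by rewrite /M ltnS leq_double -ltnS.
Qed.

(** * Truncation modulo a power of X and comparison of the two sides *)

Lemma rmorph_mult_series (R S : comNzRingType) (h : {rmorphism R -> S}) x M N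
    (W : nat -> nat -> nat -> nat) :
  h (\sum_(j < N) \prod_(1 <= i < M.+1) mult_series x M i (W j i)) =
  \sum_(j < N) \prod_(1 <= i < M.+1) mult_series (h x) M i (W j i).
Proof.
rewrite rmorph_sum; apply: eq_bigr => j _; rewrite rmorph_prod.
apply: eq_bigr => i _; rewrite rmorph_sum; apply: eq_bigr => k _.
by rewrite rmorphM rmorph_nat rmorphXn.
Qed.

Lemma in_qpoly_Xn_coef (R : comNzRingType) N (p q : {poly R}) n : (n < N)%N ->
  in_qpoly 'X^N p = in_qpoly 'X^N q -> p`_n = q`_n.
Proof.
case: N => // N lt_n /(congr1 val) /=; rewrite mk_monic_Xn /= => eq_pq.
have coef_mod (r : {poly R}) : r`_n = (Pdiv.CommonRing.rmodp r 'X^(N.+1))`_n.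
  rewrite {1}(Pdiv.RingMonic.rdivp_eq (monicXn R N.+1) r).
  by rewrite coefD coefMXn lt_n add0r.
by rewrite coef_mod eq_pq -coef_mod.
Qed.

Lemma sum_prod_dom_uic (R : comNzRingType) (x : R) n :
  let M := n.*2.+1 in x ^+ M.+1 = 0 ->
  \sum_(j < n.+1) \prod_(1 <= i < M.+1) mult_series x M i (dom_weight j i) =
  \sum_(j < n.+1) \prod_(1 <= i < M.+1) mult_series x M i (fun k => uic_cond j i k).
Proof.
move=> M x_nilp.
have le_jM (j : 'I_n.+1) : (j.*2.+1 <= M)%N by rewrite ltnS leq_double -ltnS.
transitivity (\prod_(1 <= i < M.+1) (if odd i then 1 else geom x M i) *
    \sum_(j < n.+1) x ^+ 'C(j.*2.+1, 2) * pochN x M j.*2.+1).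
  rewrite mulr_sumr; apply: eq_bigr => j _.
  rewrite -(prod_dom_factor x (le_jM j)) -big_split.
  by apply: eq_big_nat => i /andP[i_gt0 _]; rewrite mult_series_dom.
transitivity (\prod_(1 <= i < M.+1) geom x M i *
    \sum_(j < n.+1) x ^+ ('C(j.+1, 2) + j ^ 2) * (1 - x ^+ j.*2.+1)); last first.
  rewrite mulr_sumr; apply: eq_bigr => j _.
  rewrite -(prod_uic_factor x (le_jM j)) -big_split.
  by apply: eq_big_nat => i /andP[i_gt0 _]; rewrite mult_series_uic.
(* The factor [pochN 0] from the false theta identity supplies, by Euler's theorem, the missing odd
   geometric series. *)
rewrite (rogers_false_theta x_nilp) // -(prod_odd_geom x_nilp) mulrA; congr (_ * _).
rewrite [RHS](bigID odd) /= mulrC; congr (_ * _).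
by rewrite [RHS]big_mkcond; apply: eq_bigr => i _; case: odd.
Qed.

Local Close Scope ring_scope.

Theorem theorem5p2 :
  gen_series P_dom (fun p => 2 ^ tau p) =1 gen_series U_ic (fun _ => 1).
Proof.
move=> n; pose M := n.*2.+1.
apply/eqP; rewrite -(Num.Theory.eqr_nat int); apply/eqP.
rewrite (gen_series_coef (W := dom_weight)); last first.
  by move=> s j s_le; apply: prod_dom_weight.
rewrite (gen_series_coef (W := fun j i k => uic_cond j i k)); last first.
  by move=> s j s_le le_j; rewrite prod_uic_cond // muln1.
(* Coefficient n survives reduction modulo X^(M+1), where the class of X is nilpotent as the
   identity requires. *)
apply: (@in_qpoly_Xn_coef _ M.+1); first by rewrite /M -addnn; lia.
have qX0 : (in_qpoly 'X^(M.+1) 'X ^+ M.+1 = 0 :> {poly %/ ('X^(M.+1) : {poly int})})%R.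
  rewrite -rmorphXn; apply: val_inj => /=.
  by rewrite mk_monic_Xn Pdiv.RingMonic.rmodpp ?monicXn.
rewrite (rmorph_mult_series _ _ _ _ dom_weight).
rewrite (rmorph_mult_series _ _ _ _ (fun j i k => uic_cond j i k)).
exact: sum_prod_dom_uic qX0.
Qed.
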